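(* Let $I=[0,1]$ and $F=F_{\{1/2,3\}}=\{(x,3x):x\in[0,\tfrac13]\}\cup\{(x,\tfrac x2):x\in[0,1]\}\subseteq I^2$. Then the dynamical systems $(I_F^+,\sigma_F^+)$ and $(I_F,\sigma_F)$ are not topologically mixing.
   Context: For a closed relation $F\subseteq X\times X$ on a compact metric space $X$: $X_F^+=\{(x_1,x_2,\ldots)\in X^{\mathbb N}: (x_i,x_{i+1})\in F\ \forall i\ge 1\}$ with shift $\sigma_F^+(x_1,x_2,\ldots)=(x_2,x_3,\ldots)$; $X_F=\{(x_i)_{i\in\mathbb Z}\in X^{\mathbb Z}: (x_i,x_{i+1})\in F\ \forall i\in\mathbb Z\}$ with shift $(\sigma_F(\mathbf x))_i=x_{i+1}$. Both carry the topology inherited from the product topology. A dynamical system $(Y,f)$ ($Y$ compact metric, $f:Y\to Y$ continuous) is topologically mixing if for all nonempty open $U,V\subseteq Y$ there is a non-negative integer $n_0$ such that $f^n(U)\cap V\ne\emptyset$ for every positive integer $n\ge n_0$. *)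

(* Defs.v *)
From HB Require Import structures.
From mathcomp Require Import all_boot all_order all_algebra.
From mathcomp Require Import all_classical all_reals all_analysis.

Set Implicit Arguments.
Unset Strict Implicit.
Unset Printing Implicit Defensive.

Import Order.TTheory GRing.Theory Num.Theory.
Import numFieldNormedType.Exports.

Local Open Scope classical_set_scope.
Local Open Scope ring_scope.

Definition topologically_mixing (Y : topologicalType) (f : Y -> Y) : Prop :=
  forall U V : set Y, open U -> open V -> U !=set0 -> V !=set0 ->
  exists n0 : nat, forall n : nat, (0 < n)%N -> (n0 <= n)%N ->
    (iter n f @` U) `&` V !=set0.

(* [{ptws _ -> X}] carries the product topology; a set [A] used as a type is
   the subtype [set_type A], which carries the inherited (initial) topology. *)
Section Mahavier.
Context {X : topologicalType} (F : set (X * X)).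

(* The paths (x_1, x_2, ...) are indexed from 0 here: x_i is [x i.-1]. *)
Definition forward_paths : set {ptws nat -> X} :=
  [set x | forall i : nat, F (x i, x i.+1)].

Definition two_sided_paths : set {ptws int -> X} :=
  [set x | forall i : int, F (x i, x (i + 1))].

Lemma forward_shift_subproof (x : forward_paths) :
  (fun i : nat => \val x i.+1) \in forward_paths.
Proof. by apply/mem_set => i; exact: (set_mem (valP x)). Qed.

Lemma two_sided_shift_subproof (x : two_sided_paths) :
  (fun i : int => \val x (i + 1)) \in two_sided_paths.
Proof. by apply/mem_set => i; exact: (set_mem (valP x)). Qed.

Definition forward_shift (x : forward_paths) : forward_paths :=
  exist _ (fun i : nat => \val x i.+1) (forward_shift_subproof x).

Definition two_sided_shift (x : two_sided_paths) : two_sided_paths :=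
  exist _ (fun i : int => \val x (i + 1)) (two_sided_shift_subproof x).

Lemma ptws_continuous (Y : topologicalType) (I : Type)
    (g : Y -> {ptws I -> X}) :
  (forall i, continuous (fun y => g y i)) -> continuous g.
Proof.
move=> cg y; have FG := fmap_filter g (nbhs_filter y).
apply/cvg_sup => i.
exact: (@continuous_comp_initial _ Y X (fun f : I -> X => f i) g (cg i)).
Qed.

Lemma coord_continuous (I : eqType) (A : set {ptws I -> X}) (i : I) :
  continuous (fun x : A => \val x i).
Proof.
move=> x; apply: (@continuous_comp _ _ _ set_val (fun f : {ptws I -> X} => f i)).
  exact: initial_continuous.
exact: (@proj_continuous I (fun=> X) i).
Qed.

Lemma forward_shift_continuous : continuous forward_shift.
Proof.
apply: continuous_comp_initial; apply: ptws_continuous => i.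
exact: coord_continuous.
Qed.

Lemma two_sided_shift_continuous : continuous two_sided_shift.
Proof.
apply: continuous_comp_initial; apply: ptws_continuous => i.
exact: coord_continuous.
Qed.
End Mahavier.
Arguments forward_shift {X} F x.
Arguments two_sided_shift {X} F x.

Definition unit_interval (R : realType) : set R := `[0, 1].
Arguments unit_interval : clear implicits.

Definition F_half_three (R : realType) :
    set (unit_interval R * unit_interval R) :=
  [set p | (\val p.1 <= 3^-1 /\ \val p.2 = 3 * \val p.1)
           \/ \val p.2 = \val p.1 / 2].
Arguments F_half_three : clear implicits.

Lemma F_half_three_closed (R : realType) : closed (F_half_three R).
Proof.
have c1 : continuous (fun p : unit_interval R * unit_interval R => \val p.1 : R).
  move=> p; apply: (@continuous_comp _ _ _ fst set_val); first exact: cvg_fst.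
  exact: initial_continuous.
have c2 : continuous (fun p : unit_interval R * unit_interval R => \val p.2 : R).
  move=> p; apply: (@continuous_comp _ _ _ snd set_val); first exact: cvg_snd.
  exact: initial_continuous.
apply: closedU; first apply: closedI.
- by apply: (closed_comp _ (@closed_le R 3^-1)) => p _; exact: c1.
- rewrite [X in closed X](_ : _ = (fun p : unit_interval R * unit_interval R =>
    \val p.2 - 3 * \val p.1) @^-1` [set 0]).
    apply: closed_comp; last exact: closed_eq.
    by move=> p _; apply: cvgB; [exact: c2 | apply: cvgMr; exact: c1].
  by apply/seteqP; split => p /= Hp; [rewrite Hp subrr | exact: subr0_eq].
- rewrite [X in closed X](_ : _ = (fun p : unit_interval R * unit_interval R =>
    \val p.2 - \val p.1 / 2) @^-1` [set 0]).
    apply: closed_comp; last exact: closed_eq.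
    by move=> p _; apply: cvgB; [exact: c2 | apply: cvgMl; exact: c1].
  by apply/seteqP; split => p /= Hp; [rewrite Hp subrr | exact: subr0_eq].
Qed.

(* Main.v *)
(** Along a path every step multiplies by [3 = 6 / 2] or by [1 / 2], so
    [x_n = 6 ^ a * 2 ^ - n * x_0]: modulo powers of [6], one step is a rotation
    by [1 / 2].  A window narrow enough multiplicatively therefore cannot
    return to itself at two consecutive times, whereas mixing would force it to
    do so at all large times. *)
Require Import Defs.
From mathcomp Require Import all_boot all_order all_algebra.
From mathcomp Require Import all_classical all_reals all_analysis.
From mathcomp Require Import ring lra.
Import Order.TTheory GRing.Theory Num.Theory.
Import numFieldNormedType.Exports.

Local Open Scope classical_set_scope.
Local Open Scope ring_scope.

Section Window.
Context {R : realType}.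
Implicit Types (u v : R) (n a b : nat).

Lemma iter_half_three (Y : Type) (f : Y -> Y) (p : Y -> R) :
    (forall y, p (f y) = 3 * p y \/ p (f y) = p y / 2) ->
  forall n y, exists a, p (iter n f y) * 2 ^+ n = 6 ^+ a * p y.
Proof.
move=> fp n y; elim: n => [|n [a IHn]]; first by exists 0; rewrite mulr1 mul1r.
(* The exponent counts the triplings: against the extra factor 2, a tripling contributes a new 6 and
   a halving contributes 1. *)
by case: (fp (iter n f y)) => /= ->; [exists a.+1 | exists a];
  rewrite !exprS -?mulrA -IHn; lra.
Qed.

(** Dividing the two return equations gives [6 ^ (b - a) = 2 * (u * v') / (v * u')]. The window
    bounds put the right side between 9/8 and 32/9, hence strictly between 1 and 6, where no integer
    power of 6 lies. *)
Lemma no_consecutive_returns n a b u v u' v' :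
  2^-1 < u < 2 / 3 -> 2^-1 < v < 2 / 3 ->
  2^-1 < u' < 2 / 3 -> 2^-1 < v' < 2 / 3 ->
  v * 2 ^+ n = 6 ^+ a * u -> v' * 2 ^+ n.+1 = 6 ^+ b * u' -> False.
Proof.
move=> /andP[u0 u1] /andP[v0 v1] /andP[u0' u1'] /andP[v0' v1'] E E'.
have exp6_ge1 k : 1 <= 6 ^+ k :> R by apply: exprn_ege1; lra.
have n0 : 2 ^+ n != 0 :> R by rewrite expf_neq0 // pnatr_eq0.
have uv' : 4^-1 < u * v' < 4 / 9 by apply/andP; split; nra.
have vu' : 4^-1 < v * u' < 4 / 9 by apply/andP; split; nra.
have cross : 6 ^+ b * (v * u') = 6 ^+ a * (2 * (u * v')).
  apply: (mulIf n0); transitivity (v * 2 ^+ n * (6 ^+ b * u')); first by ring.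
  by rewrite E -E' exprS; ring.
have [le_ba|lt_ab] := leqP b a.
(* After cancelling [6 ^+ b], the right side exceeds 1/2 while [v * u' < 4 / 9]. *)
- have b0 : 6 ^+ b != 0 :> R by rewrite expf_neq0 // pnatr_eq0.
  move: cross; rewrite -(subnKC le_ba) exprD -mulrA => /(mulfI b0).
  by have := exp6_ge1 (a - b)%N; nra.
(* Here at least one factor 6 survives on the left, which exceeds 6/4, while
   [2 * (u * v') < 8 / 9]. *)
- have a0 : 6 ^+ a != 0 :> R by rewrite expf_neq0 // pnatr_eq0.
  move: cross; rewrite -(subnKC lt_ab) addSnnS exprD -mulrA => /(mulfI a0).
  by rewrite exprS; have := exp6_ge1 (b - a.+1)%N; nra.
Qed.

(** The observable [p] is abstract so that the zeroth coordinate of either shift can be used; 7/12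
    is the midpoint of the window and makes it nonempty. *)
Lemma half_three_not_mixing (Y : topologicalType) (f : Y -> Y) (p : Y -> R) :
    continuous p -> (forall y, p (f y) = 3 * p y \/ p (f y) = p y / 2) ->
    (exists y, p y = 7 / 12) ->
  ~ topologically_mixing f.
Proof.
move=> cp fp [y py] mix.
pose U := p @^-1` `]2^-1, 2 / 3[.
have oU : open U by apply: open_comp => [z _|]; [exact: cp|exact: interval_open].
have U0 : U !=set0 by exists y; rewrite /U /= in_itv /= py; apply/andP; split; lra.
have [n0 {}mix] := mix U U oU oU U0 U0.
have [_ [[u Uu <-] Uv]] := mix n0.+1 isT (leqnSn _).
have [_ [[u' Uu' <-] Uv']] := mix n0.+2 isT (leqW (leqnSn _)).
have [a E] := iter_half_three _ _ _ fp n0.+1 u.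
have [b E'] := iter_half_three _ _ _ fp n0.+2 u'.
move: Uu Uv Uu' Uv'; rewrite /U /preimage /= !in_itv => Uu Uv Uu' Uv'.
exact: no_consecutive_returns Uu Uv Uu' Uv' E E'.
Qed.

Lemma F_half_three_step (x y : unit_interval R) :
  F_half_three R (x, y) -> \val y = 3 * \val x \/ \val y = \val x / 2.
Proof. by case=> [[_ ?]|?]; [left|right]. Qed.

(** Halving forwards and dividing by 3 backwards from 7/12 keeps the whole orbit in the unit
    interval. [Negz n] stands for [-(n + 1)], hence the exponent [n.+1]. *)
Definition sample_path (i : int) : R :=
  match i with Posz n => 7 / 12 / 2 ^+ n | Negz n => 7 / 12 / 3 ^+ n.+1 end.

Lemma sample_path_itv i : sample_path i \in unit_interval R.
Proof.
have H (k : R) n : 1 <= k -> 7 / 12 / k ^+ n \in unit_interval R.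
  move=> k1; have kn1 : 1 <= k ^+ n by exact: exprn_ege1.
  apply/mem_set; rewrite /unit_interval /= in_itv /=.
  have kn0 : 0 < k ^+ n by lra.
  by rewrite divr_ge0 ?ler_pdivrMr //; lra.
by case: i => n; apply: H; lra.
Qed.

Definition sample_point (i : int) : unit_interval R :=
  exist _ (sample_path i) (sample_path_itv i).

Lemma sample_point_step i :
  F_half_three R (sample_point i, sample_point (i + 1)).
Proof.
case: i => [n|[|n]].
- by rewrite -PoszD addn1; right; rewrite /= exprS invfM; lra.
(* The step from index -1 to 0 crosses the two branches; tripling is allowed since 7/36 is below
   1/3. *)
- left; rewrite /= expr1 expr0; split; lra.
- have -> : Negz n.+1 + 1 = Negz n by rewrite !NegzE -addn1 PoszD opprD addrNK.
  left; rewrite /= (exprS _ n.+1) invfM.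
  have n1 : 1 <= 3 ^+ n.+1 :> R by apply: exprn_ege1; lra.
  have : (3 ^+ n.+1)^-1 <= 1 :> R by rewrite invf_le1 //; lra.
  by split; lra.
Qed.

End Window.

Theorem proposition5p2 (R : realType) :
  ~ topologically_mixing (forward_shift (F_half_three R)) /\
  ~ topologically_mixing (two_sided_shift (F_half_three R)).
Proof.
have cval : continuous (\val : unit_interval R -> R) by exact: initial_continuous.
split.
- apply: (half_three_not_mixing _ _
    (fun x : forward_paths (F_half_three R) => \val (\val x 0%N))).
  + move=> x; apply: (@continuous_comp _ _ _
      (fun x : forward_paths (F_half_three R) => \val x 0%N) \val).
      exact: Defs.coord_continuous.
    exact: cval.
  + by move=> x; apply: F_half_three_step; exact: (set_mem (valP x)).
  (* The nonnegative half of the same bi-infinite path is the forward witness. *)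
  + have xF : (fun n : nat => sample_point n) \in forward_paths (F_half_three R).
      by apply/mem_set => n; rewrite -addn1; exact: sample_point_step.
    by exists (exist (fun x => x \in forward_paths (F_half_three R)) _ xF); rewrite /= expr0 divr1.
- apply: (half_three_not_mixing _ _
    (fun x : two_sided_paths (F_half_three R) => \val (\val x 0))).
  + move=> x; apply: (@continuous_comp _ _ _
      (fun x : two_sided_paths (F_half_three R) => \val x 0) \val).
      exact: Defs.coord_continuous.
    exact: cval.
  + by move=> x; apply: F_half_three_step; exact: (set_mem (valP x)).
  + have xF : sample_point \in two_sided_paths (F_half_three R).
      by apply/mem_set => i; exact: sample_point_step.
    by exists (exist (fun x => x \in two_sided_paths (F_half_three R)) _ xF); rewrite /= expr0 divr1.
Qed.
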